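(* Let $G$ be a finite group and $N$ a normal subgroup of $G$ such that $G/N$ is isomorphic to a symmetric group (i.e. $G/N\cong S_m$ for some integer $m\ge 1$). If $\alpha(G)=\alpha(G/N)$, then $N$ is an elementary abelian $2$-group and it admits a normal complement in $G$, so that $G\cong N\times G/N$.
   Context: For a finite group $H$, $c(H)$ denotes the number of cyclic subgroups of $H$ (including the trivial one) and $\alpha(H):=c(H)/|H|$. $S_m$ denotes the symmetric group of degree $m$. The trivial group is regarded as an elementary abelian $2$-group. A normal complement of $N$ in $G$ is a normal subgroup $M$ of $G$ with $NM=G$ and $N\cap M=\{1\}$. *)

(* Defs.v *)
From mathcomp Require Import all_boot all_order all_algebra all_fingroup all_solvable.

Set Implicit Arguments.
Unset Strict Implicit.
Unset Printing Implicit Defensive.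

Import GroupScope.

Definition num_cyclic (gT : finGroupType) (H : {group gT}) : nat :=
  #|[set C in subgroups H | cyclic C]|.

Definition alpha (gT : finGroupType) (H : {group gT}) : rat :=
  ((num_cyclic H)%:R / #|H|%:R)%R.

(* Main.v *)
Require Import Defs.
From mathcomp Require Import all_boot all_order all_algebra all_fingroup all_solvable.

Import GroupScope.

(** A cyclic group of order n has totient n generators, so the number of cyclic
subgroups of H is the sum over x in H of 1 / totient #[x] ([num_cyclicE]).
Averaging over cosets, alpha (G / N) is the mean over x in G of
1 / totient #[coset N x], and it dominates alpha G term by term because the
order of coset N x divides that of x and totient is monotone for divisibility.
Equality of the means forces totient #[coset N x] = totient #[x] for every x
([alpha_quotient_eq]). The integers of totient 1 are 1 and 2, so in particular
x ^+ 2 = 1 whenever x ^+ 2 lies in N; for x in N this makes N an elementary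
abelian 2-group.

Let phi : G -> Sym T be onto with kernel N. The condition says that phi reflects
elements of square 1, hence also commutation of such elements, because x and y
of square 1 commute exactly when (x * y) ^+ 2 = 1
([commute_involution_lifts]). Lifts of transpositions therefore centralise N,
and since transpositions generate Sym T, the kernel is central.

It remains to split this central extension. Let t lift the transposition (a b).
The centraliser of (a b) is generated by (a b) and the transpositions disjoint
from it, all of whose lifts commute with t. So the conjugacy class of t maps
bijectively onto the transpositions: each (i j) has one distinguished lift
d i j, and this choice is invariant under conjugation
([equivariant_tperm_lift]). Such a system d generates a group M of order at most
#|T|`! ([card_gen_tperm_like]). As M maps onto Sym T, it meets N trivially, and
it is normal because G = N * M with N central. *)

(** * Cyclic subgroups and the totient of element orders *)

Lemma leq_totient_mul_prime (d p : nat) :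
  0 < d -> prime p -> totient d <= totient (d * p).
Proof.
move=> d_gt0 pr_p; have [m co_pm ->] := pfactor_coprime pr_p d_gt0.
rewrite -mulnA -expnSr !totient_coprime ?coprimeXr 1?coprime_sym //.
rewrite leq_mul2l; apply/orP; right.
case: (logn p d) => [|k]; first by rewrite totient_gt0 expn_gt0 prime_gt0.
by rewrite !totient_pfactor //= leq_mul2l leq_pexp2l ?prime_gt0 ?orbT.
Qed.

(** Divide n by d one prime factor at a time. *)
Lemma leq_totient_dvd (d n : nat) : 0 < n -> d %| n -> totient d <= totient n.
Proof.
move=> n_gt0 /dvdnP[e def_n]; move: n_gt0; rewrite {n}def_n.
have [k] := ubnP e; elim: k e => // k IHk e; rewrite ltnS => le_ek.
rewrite muln_gt0 => /andP[e_gt0 d_gt0].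
have [e_gt1|] := ltnP 1 e; last by case: e e_gt0 {le_ek} => [|[]] //; rewrite mul1n.
have pr_p := pdiv_prime e_gt1; have def_e := divnK (pdiv_dvd e).
have q_gt0 : 0 < e %/ pdiv e by rewrite divn_gt0 ?pdiv_gt0 ?pdiv_leq.
have qd_gt0 : 0 < e %/ pdiv e * d by rewrite muln_gt0 q_gt0.
apply: leq_trans (IHk _ _ qd_gt0) _.
  by apply: leq_trans le_ek; rewrite ltn_Pdiv ?prime_gt1.
by rewrite -{3}def_e mulnAC leq_totient_mul_prime.
Qed.

(** Group the elements of H according to the cyclic subgroup that they generate:
the totient #[a] generators of <[a]> contribute 1 in total. *)
Lemma num_cyclicE {gT : finGroupType} (H : {group gT}) :
  ((num_cyclic H)%:R = \sum_(x in H) (totient #[x])%:R^-1 :> rat)%R.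
Proof.
pose cyc := [set C in subgroups H | cyclic C].
rewrite (partition_big (fun x => <[x]>%G) (mem cyc)) /=; last first.
  by move=> x Hx; rewrite !inE cycle_subG Hx cycle_cyclic.
rewrite -[num_cyclic H]/#|cyc| -sum1_card GRing.natr_sum.
apply: eq_bigr => C; rewrite inE => /andP[]; rewrite inE => sCH /cyclicP[a defC].
have tot_gt0 : ((totient #[a])%:R != 0 :> rat)%R.
  by rewrite Num.Theory.pnatr_eq0 -lt0n totient_gt0 order_gt0.
transitivity (\sum_(x | generator <[a]> x) (totient #[a])%:R^-1 : rat)%R.
  rewrite GRing.sumr_const -cardsE -totient_gen -[RHS]GRing.mulr_natr.
  by rewrite GRing.mulVf.
apply: eq_big => [x|x gen_x]; last by rewrite (generator_order gen_x).
rewrite -val_eqE /= defC /generator eq_sym andb_idl // => /eqP x_gen.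
by rewrite -cycle_subG x_gen -defC.
Qed.

Lemma sum_quotient {gT : finGroupType} (G N : {group gT})
    (F : coset_of N -> rat) : N <| G ->
  (\sum_(x in G) F (coset N x) = #|N|%:R * \sum_(y in (G / N)%g) F y)%R.
Proof.
move=> nsNG; have nNG := normal_norm nsNG.
rewrite (partition_big (coset N) (mem (G / N))) /=; last first.
  by move=> x Gx; apply: mem_quotient.
rewrite GRing.mulr_sumr; apply: eq_bigr => _ /morphimP[a Na Ga ->].
rewrite (eq_bigr (fun=> F (coset N a))) => [|x /andP[_ /eqP->] //].
rewrite GRing.sumr_const -[LHS]GRing.mulr_natl -(card_rcoset N a).
congr (_%:R * _)%R; apply: eq_card => x; rewrite unfold_in.
apply/andP/idP => [[Gx /eqP /rcoset_kercosetP]|Nax].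
  by apply=> //; apply: (subsetP nNG).
have Gx : x \in G.
  by case/rcosetP: Nax => n Nn ->; rewrite groupM // (subsetP (normal_sub nsNG)).
by split=> //; apply/eqP/rcoset_kercosetP => //; apply: (subsetP nNG).
Qed.

(** Both sides of the hypothesis are means over G, and the one for G / N is
larger term by term; equal means therefore have equal terms. *)
Lemma alpha_quotient_eq {gT : finGroupType} (G N : {group gT}) :
  N <| G -> alpha G = alpha (G / N)%G ->
  {in G, forall x, totient #[coset N x] = totient #[x]}.
Proof.
move=> nsNG; have nNG := normal_norm nsNG.
have nz (H : {group gT}) : (#|H|%:R != 0 :> rat)%R.
  by rewrite Num.Theory.pnatr_eq0 -lt0n.
have cardG : (#|G|%:R = #|N|%:R * #|(G / N)%g|%:R :> rat)%R.
  by rewrite card_quotient // -GRing.natrM Lagrange ?normal_sub.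
rewrite /alpha !num_cyclicE => eq_alpha.
have eq_sum : (\sum_(x in G) (totient #[x])%:R^-1 =
               \sum_(x in G) (totient #[coset N x])%:R^-1 :> rat)%R.
  rewrite (@sum_quotient _ _ _ (fun y => (totient #[y])%:R^-1)%R nsNG).
  apply: (GRing.mulIf (GRing.invr_neq0 (nz G))); rewrite eq_alpha.
  by rewrite cardG GRing.invfM GRing.mulrACA GRing.mulfV ?nz // GRing.mul1r.
have le x : x \in G ->
    (((totient #[x])%:R^-1 : rat) <= (totient #[coset N x])%:R^-1
       ?= iff (totient #[coset N x] == totient #[x]))%R.
  move=> Gx; split; last first.
    by rewrite (inj_eq GRing.invr_inj) Num.Theory.eqr_nat eq_sym.
  rewrite Num.Theory.lef_pV2 ?qualifE /= ?Num.Theory.ltr0n ?totient_gt0 //.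
  by rewrite Num.Theory.ler_nat leq_totient_dvd ?morph_order ?(subsetP nNG).
have [_] := Num.Theory.leif_sum le; rewrite eq_sum eqxx => /esym/forall_inP eqG.
by move=> x /eqG/eqP.
Qed.

(** * Transpositions *)

Lemma tperm_sqr {T : finType} (a b : T) : tperm a b ^+ 2 = 1.
Proof. by rewrite expgS expg1 tperm2. Qed.

(** The only relations of Sym T that are assumed are those expressing how
transpositions square and conjugate one another, and they already bound the size
of the group. For a in A and B = A :\ a, let H be the group generated by the
d i j with i, j in B: multiplying on the right by a generator permutes the cosets
H * d a i with i in A, the coset H itself being the one with i = a. So these at
most #|A| cosets of H cover the group. *)
Lemma card_gen_tperm_like {gT : finGroupType} {T : finType} (d : T -> T -> gT)
    (d1 : forall i, d i i = 1) (dC : forall i j, d i j = d j i)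
    (dd : forall i j, d i j * d i j = 1)
    (dJ : forall i j k l, d i j ^ d k l = d (tperm k l i) (tperm k l j))
    (A : {set T}) :
  #|<<d @2: (A, A)>>| <= #|A|`!.
Proof.
move: {2}#|A| (leqnn #|A|) => n; elim: n A => [|n IHn] A leAn.
  move: leAn; rewrite leqn0 cards_eq0 => /eqP->.
  suff ->: d @2: (set0, set0) = set0 by rewrite gen0 cards1 cards0.
  by apply/setP=> x; rewrite inE; apply/negP=> /imset2P[i j]; rewrite inE.
have [->|[a Aa]] := set_0Vmem A.
  apply: leq_trans (IHn set0 _) _; rewrite cards0 //.
pose B := A :\ a; pose H := <<d @2: (B, B)>>%G; pose X := d a @: A.
have cardA : #|A| = #|B|.+1 by rewrite (cardsD1 a) Aa.
have dB i j : i \in B -> j \in B -> d i j \in H.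
  by move=> Bi Bj; rewrite mem_gen ?imset2_f.
have HX1 i j k : i \in B -> j \in B -> k \in A -> d i j * d a k \in H * X.
  by move=> Bi Bj Ak; rewrite mem_mulg ?dB ?imset_f.
have HXa k : k \in A -> d a k \in H * X.
  by move=> Ak; rewrite -[d a k]mul1g mem_mulg ?group1 ?imset_f.
have stepa i k : i \in A -> k \in A -> d a i * d a k \in H * X.
  move=> Ai Ak; have [->|nia] := eqVneq i a; first by rewrite d1 mul1g HXa.
  have [->|nka] := eqVneq k a; first by rewrite d1 mulg1 HXa.
  have [->|nik] := eqVneq i k; first by rewrite dd -(d1 a) HXa.
  (* The identity x * y = y ^ x^-1 * x, with x an involution. *)
  have ->: d a i * d a k = d i k * d a i.
    have dV : (d a i)^-1 = d a i by apply/eqP; rewrite eq_invg_mul dd.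
    have := dJ a k a i; rewrite tpermL tpermD // 1?eq_sym // => <-.
    by rewrite conjgE dV -!mulgA dd mulg1.
  by rewrite HX1 // !inE ?nia ?nka.
have step i j k : i \in A -> j \in A -> k \in A -> d a i * d j k \in H * X.
  move=> Ai Aj Ak; have [->|nja] := eqVneq j a; first exact: stepa.
  have [->|nka] := eqVneq k a; first by rewrite (dC j) stepa.
  (* Here j and k lie in B: d j k moves to the left, into H, and conjugates
     d a i into some d a i'. *)
  rewrite conjgC dJ tpermD // HX1 ?inE ?nja ?nka //.
  by case: tpermP.
have stab : <<d @2: (A, A)>> \subset 'N(H * X | 'R).
  rewrite gen_subG; apply/subsetP=> _ /imset2P[j k Aj Ak ->].
  rewrite !inE /=; apply/subsetP=> _ /mulsgP[h _ Hh /imsetP[i Ai ->] ->].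
  rewrite inE /= -mulgA.
  have /mulsgP[h' x Hh' Xx ->] := step i j k Ai Aj Ak.
  by rewrite mulgA mem_mulg ?groupM.
have sub : <<d @2: (A, A)>> \subset H * X.
  apply/subsetP=> g /(subsetP stab) Ng; rewrite -[g]mul1g.
  by rewrite (astabs_act 1 Ng) -(d1 a) HXa.
apply: leq_trans (subset_leq_card sub) _; rewrite cardA factS mulnC -cardA.
rewrite -[H * X]/(mulg @2: (H, X)) curry_imset2X.
apply: leq_trans (leq_imset_card _ _) _.
rewrite cardsX leq_mul ?leq_imset_card //.
by rewrite IHn // -ltnS -cardA.
Qed.

(** Induction on the number of moved points: if s moves z, then
s * tperm z (s z) fixes z and every fixed point of s. *)
Lemma mem_perm_on {T : finType} (H : {group {perm T}}) (A : {set T}) :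
  {in A &, forall c d, tperm c d \in H} ->
  forall s, perm_on A s -> s \in H.
Proof.
move=> HA s; have [n] := ubnP #|[set z | s z != z]|; elim: n s => // n IHn s.
rewrite ltnS => le_s_n As; have [s1|[z]] := set_0Vmem [set z | s z != z].
  suff ->: s = 1 by exact: group1.
  apply/permP=> z; rewrite perm1; apply/eqP/idPn=> sz.
  by have := in_set0 z; rewrite -s1 inE sz.
rewrite inE => szz; have Az : z \in A by apply: (subsetP As).
have Asz : s z \in A by rewrite perm_closed.
have Ht : tperm z (s z) \in H by apply: HA.
rewrite -(groupMr _ Ht) IHn //; last first.
  apply: perm_onM => //; apply: subset_trans (tperm_on _ _) _.
  by apply/subsetP=> y; rewrite !inE => /pred2P[]->.
apply: leq_trans le_s_n; apply: proper_card; apply/properP; split.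
  apply/subsetP=> y; rewrite !inE permM; apply: contraNneq => sy.
  rewrite sy tpermD //; first by apply: contraNneq szz => zy; rewrite zy sy.
  by apply: contraNneq szz => szy; apply/eqP/(@perm_inj _ s); rewrite szy.
by exists z; rewrite !inE ?permM ?tpermR ?szz ?eqxx.
Qed.

Lemma group_of_tperms {T : finType} (H : {group {perm T}}) :
  (forall c d, tperm c d \in H) -> H :=: setT.
Proof.
move=> Hcd; apply/setP=> s; rewrite inE.
apply: (@mem_perm_on _ H setT) => [c d _ _ //|].
by apply/subsetP=> x; rewrite inE.
Qed.

(** A permutation that commutes with (a b) preserves {a, b}; up to a factor (a b)
it fixes both points, and is then a product of transpositions away from them. *)
Lemma centralizer_tperm_sub {T : finType} (H : {group {perm T}}) (a b : T) :
  a != b -> tperm a b \in H ->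
  (forall c d, c \notin [set a; b] -> d \notin [set a; b] -> tperm c d \in H) ->
  'C[tperm a b] \subset H.
Proof.
move=> neq_ab Hab Hcd; apply/subsetP=> s /cent1P cs.
have fix_ab (u : {perm T}) : u a = a -> u b = b -> u \in H.
  move=> ua ub; apply: (@mem_perm_on _ H (~: [set a; b])).
    by move=> c d; rewrite !(in_setC _ [set a; b]); apply: Hcd.
  apply/subsetP=> y; rewrite !inE; apply: contraNN => /pred2P[]->; exact/eqP.
have tJ : tperm (s a) (s b) = tperm a b by rewrite -tpermJ conjgE -cs mulKg.
have neq_sab : s b != s a by rewrite (inj_eq perm_inj) eq_sym.
move/permP/(_ (s a)): (tJ); rewrite tpermL; case: tpermP => [sa sb|sa sb|_ _ /eqP].
- exact: fix_ab.
- by rewrite -(groupMr _ Hab) fix_ab // permM ?sa ?sb ?tpermL ?tpermR.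
by rewrite (negbTE neq_sab).
Qed.

(** * Extensions of symmetric groups in which involutions lift to involutions *)

(** Modulo the kernel x * y has square 1, so x, y and x * y are their own inverses
in G, whence x * y = (x * y)^-1 = y * x. *)
Lemma commute_involution_lifts {gT rT : finGroupType} {G : {group gT}}
    (phi : {morphism G >-> rT})
    (phi2 : {in G, forall x, phi x ^+ 2 = 1 -> x ^+ 2 = 1}) (x y : gT) :
  x \in G -> y \in G -> phi x ^+ 2 = 1 -> phi y ^+ 2 = 1 ->
  commute (phi x) (phi y) -> commute x y.
Proof.
move=> Gx Gy x2 y2 cxy.
have invE z : z \in G -> phi z ^+ 2 = 1 -> z^-1 = z.
  by move=> Gz /(phi2 z Gz)/eqP; rewrite expgS expg1 -eq_invg_mul => /eqP.
have xy2 : phi (x * y) ^+ 2 = 1 by rewrite morphM // expgMn // x2 y2 mulg1.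
by have := invE _ (groupM Gx Gy) xy2; rewrite invMg !invE.
Qed.

(** An element of the kernel is itself a lift of an element of square 1, so it
commutes with all lifts of transpositions. The centraliser of the kernel thus
maps onto the symmetric group; it contains the kernel, hence is all of G. *)
Lemma central_ker_Sym {gT : finGroupType} {T : finType} {G : {group gT}}
    (phi : {morphism G >-> {perm T}}) (imG : phi @* G = setT)
    (phi2 : {in G, forall x, phi x ^+ 2 = 1 -> x ^+ 2 = 1}) :
  G \subset 'C('ker phi).
Proof.
set K := 'ker phi.
have cK y : y \in G -> phi y ^+ 2 = 1 -> y \in 'C(K).
  move=> Gy y2; apply/centP=> z Kz; have Gz := dom_ker Kz.
  apply: (commute_involution_lifts phi phi2) => //.
    by rewrite (mker Kz) expg1n.
  by rewrite /commute (mker Kz) mulg1 mul1g.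
have sKC : K \subset 'C_G(K).
  apply/subsetP=> z Kz; have Gz := dom_ker Kz.
  by rewrite inE Gz cK // (mker Kz) expg1n.
suff imC : phi @* 'C_G(K) = setT.
  have := morphimGK sKC (subsetIl _ _).
  by rewrite imC -imG morphimGK ?subxx ?subsetIl // => /esym/setIidPl.
apply: (@group_of_tperms _ (phi @* 'C_G(K))%G) => c d.
have : tperm c d \in phi @* G by rewrite imG inE.
case/morphimP=> y _ Gy def_y; rewrite def_y mem_morphim //.
by rewrite inE Gy cK // -def_y tperm_sqr.
Qed.

(** In general, lifts of commuting elements commute only up to the kernel. Here the
centraliser of t contains the kernel, t itself and the lifts of the transpositions
disjoint from (a b), hence the full preimage of the centraliser of (a b). *)
Lemma commute_tperm_lift {gT : finGroupType} {T : finType} {G : {group gT}}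
    (phi : {morphism G >-> {perm T}}) (imG : phi @* G = setT)
    (phi2 : {in G, forall x, phi x ^+ 2 = 1 -> x ^+ 2 = 1})
    (a b : T) (t y : gT) :
  a != b -> t \in G -> phi t = tperm a b -> y \in G ->
  commute (phi t) (phi y) -> commute t y.
Proof.
move=> neq_ab Gt def_t Gy cty.
have sKC : 'ker phi \subset 'C_G[t].
  apply/subsetP=> z Kz; have Gz := dom_ker Kz; rewrite inE Gz; apply/cent1P.
  have /centP ctK := subsetP (central_ker_Sym phi imG phi2) t Gt.
  exact/commute_sym/ctK.
have memC s x : x \in G -> phi x = s -> commute t x -> s \in phi @* 'C_G[t].
  by move=> Gx <- ctx; rewrite mem_morphim // inE Gx; apply/cent1P.
suff : y \in phi @*^-1 (phi @* 'C_G[t]).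
  by rewrite morphimGK ?subsetIl // => /setIP[_ /cent1P].
apply: mem_morphpre => //.
apply: (subsetP (@centralizer_tperm_sub _ (phi @* 'C_G[t])%G a b neq_ab _ _)).
- exact: memC Gt def_t _.
- move=> c d; rewrite !inE !negb_or => /andP[ca cb] /andP[da db].
  have : tperm c d \in phi @* G by rewrite imG inE.
  case/morphimP=> x _ Gx def_x; apply: (memC _ x) => //.
  apply: (commute_involution_lifts phi phi2) => //.
  + by rewrite def_t tperm_sqr.
  + by rewrite -def_x tperm_sqr.
  rewrite def_t -def_x; apply/commgP/conjg_fixP.
  by rewrite tpermJ !tpermD // eq_sym.
by apply/cent1P; rewrite -def_t.
Qed.

(** The distinguished lift of (i j) is its unique lift in the conjugacy class of a
fixed lift t of some transposition; uniqueness makes the choice symmetric in i, j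
and compatible with conjugation. The diagonal value 1 agrees with the convention
tperm i i = 1. *)
Lemma equivariant_tperm_lift {gT : finGroupType} {T : finType} {G : {group gT}}
    (phi : {morphism G >-> {perm T}}) (imG : phi @* G = setT)
    (phi2 : {in G, forall x, phi x ^+ 2 = 1 -> x ^+ 2 = 1}) :
  exists d : T -> T -> gT,
    [/\ forall i j, d i j \in G, forall i j, phi (d i j) = tperm i j,
        forall i, d i i = 1, forall i j, d i j = d j i
      & forall i j k l, d i j ^ d k l = d (tperm k l i) (tperm k l j)].
Proof.
have [/existsP[a /existsP[b neq_ab]] | no_ab] :=
  boolP [exists a : T, exists b : T, a != b]; last first.
  have all_eq (i j : T) : i = j.
    by move/existsPn/(_ i)/existsPn/(_ j): no_ab => /negbNE/eqP.
  exists (fun _ _ => 1); split=> // [i j|i j k l]; last by rewrite conj1g.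
  by rewrite (all_eq i j) tperm1 morph1.
have : tperm a b \in phi @* G by rewrite imG inE.
case/morphimP=> t _ Gt def_t.
have sTG : t ^: G \subset G by rewrite class_subG.
(* If t ^ g and t ^ h have the same image, then g * h^-1 commutes with t modulo
   the kernel, hence commutes with t. *)
have injT x y : x \in t ^: G -> y \in t ^: G -> phi x = phi y -> x = y.
  case/imsetP=> g Gg -> /imsetP[h Gh ->].
  rewrite !morphJ // => eq_gh.
  apply: (canRL (conjgKV _)); rewrite -conjgM; apply/conjg_fixP/commgP.
  apply: (commute_tperm_lift phi imG phi2 a b) => //.
    by rewrite groupM ?groupV.
  apply/commgP/conjg_fixP; rewrite morphM ?groupV // morphV // conjgM.
  by rewrite eq_gh conjgK.
have lift_ex i j : i != j -> exists2 x, x \in t ^: G & phi x = tperm i j.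
  (* A permutation taking a to i and b to j: first (a i), which sends b to some
     b' different from i, then (b' j). *)
  move=> neq_ij; pose b' := tperm a i b.
  have : tperm a i * tperm b' j \in phi @* G by rewrite imG inE.
  case/morphimP=> g _ Gg def_g; exists (t ^ g); first exact: memJ_class.
  rewrite morphJ // -def_g -def_t tpermJ !permM tpermL -/b' tpermL tpermD //.
    by rewrite /b' -[X in _ != X](tpermL a i) (inj_eq perm_inj) eq_sym.
  by rewrite eq_sym.
pose d i j := if i == j then 1 else
  odflt 1 [pick x in t ^: G | phi x == tperm i j].
have dP i j : i != j -> d i j \in t ^: G /\ phi (d i j) = tperm i j.
  rewrite /d => neq_ij; rewrite (negbTE neq_ij).
  case: pickP => [x /andP[Tx /eqP]|none] //=.
  by have [x Tx /eqP phi_x] := lift_ex i j neq_ij; have := none x; rewrite Tx phi_x.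
have d1 i : d i i = 1 by rewrite /d eqxx.
have dG i j : d i j \in G.
  by have [->|/dP[/(subsetP sTG)]//] := eqVneq i j; rewrite d1.
have phi_d i j : phi (d i j) = tperm i j.
  by have [->|/dP[]//] := eqVneq i j; rewrite d1 tperm1 morph1.
exists d; split=> // [i j|i j k l].
  have [->//|neq_ij] := eqVneq i j.
  have [Tij _] := dP i j neq_ij; rewrite eq_sym in neq_ij.
  have [Tji _] := dP j i neq_ij.
  by apply: injT; rewrite // !phi_d tpermC.
have [->|neq_ij] := eqVneq i j; first by rewrite !d1 conj1g.
have [Tij _] := dP i j neq_ij.
have neq_ij' : tperm k l i != tperm k l j by rewrite (inj_eq perm_inj).
have [Tij' _] := dP _ _ neq_ij'.
apply: injT => //; last by rewrite morphJ // !phi_d tpermJ.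
by rewrite memJ_norm // (subsetP (class_norm t G)).
Qed.

(** The distinguished lifts generate a group M that maps onto Sym T and has order at
most #|T|`!, so M and the kernel have trivial intersection by counting. *)
Lemma normal_complement_ker_Sym {gT : finGroupType} {T : finType}
    {G : {group gT}} (phi : {morphism G >-> {perm T}}) (imG : phi @* G = setT)
    (phi2 : {in G, forall x, phi x ^+ 2 = 1 -> x ^+ 2 = 1}) :
  exists2 M : {group gT}, M <| G & M \in [complements to 'ker phi in G].
Proof.
have [d [dG phi_d d1 dC dJ]] := equivariant_tperm_lift phi imG phi2.
have dd i j : d i j * d i j = 1.
  by have := phi2 _ (dG i j); rewrite phi_d tperm_sqr expgS expg1; apply.
pose M := <<d @2: (setT, setT)>>%G.
have sMG : M \subset G.
  by rewrite gen_subG; apply/subsetP=> _ /imset2P[i j _ _ ->].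
have cardG : #|G| = (#|'ker phi| * #|T|`!)%N.
  rewrite -(card_Sym T) -[alt.Sym T]/[set: {perm T}] -imG.
  by rewrite card_morphim setIid Lagrange ?subsetIl.
have defG : 'ker phi * M = G.
  apply/eqP; rewrite eqEsubset mul_subG ?subsetIl //=.
  have imM : phi @* M = setT.
    apply: (@group_of_tperms _ (phi @* M)%G) => i j.
    by rewrite -phi_d mem_morphim // mem_gen // imset2_f ?inE.
  by rewrite -[_ * _]morphimK // imM -imG morphimGK ?subsetIl.
exists M.
  rewrite /normal sMG -defG mul_subG ?normG //.
  rewrite cents_norm // centsC.
  exact: subset_trans sMG (central_ker_Sym phi imG phi2).
apply/complP; split=> //; apply: cardMg_TI.
rewrite defG cardG leq_mul2l /= orbC -cardsT.
by rewrite (card_gen_tperm_like d d1 dC dd dJ).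
Qed.

Lemma quotient_Sym_morphism {gT : finGroupType} {T : finType}
    (G N : {group gT}) (nsNG : N <| G) :
  G / N \isog 'Sym_T ->
  exists phi : {morphism G >-> {perm T}}, 'ker phi = N /\ phi @* G = setT.
Proof.
case/isogP=> f injf imf.
have sGdom : G \subset coset N @*^-1 (G / N) by rewrite quotientGK.
exists (restrm_morphism sGdom (comp_morphism (coset_morphism N) f)); split.
  rewrite ker_restrm ker_comp (trivgP injf) -[_ @*^-1 1]/('ker (coset N)) ker_coset.
  exact/setIidPr/normal_sub.
by rewrite morphim_restrm setIid morphim_comp imf.
Qed.

Theorem theorem1 (gT : finGroupType) (G N : {group gT}) (nNG : N <| G)
    (symGN : exists2 m : nat, 1 <= m & G / N \isog 'Sym_('I_m))
    (eq_alpha : alpha G = alpha (G / N)%G) :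
  [/\ 2.-abelem N,
      exists2 M : {group gT}, M <| G & M \in [complements to N in G]
    & G \isog setX N (G / N)].
Proof.
have totE := alpha_quotient_eq G N nNG eq_alpha.
(* Both 1 and 2 have totient 1, and no larger number does. *)
have sqr_lift : {in G, forall x, coset N x ^+ 2 = 1 -> x ^+ 2 = 1}.
  move=> x Gx xN2; have le_xN : #[coset N x] <= 2.
    by rewrite dvdn_leq // order_dvdn xN2.
  apply/eqP; rewrite -order_dvdn.
  have : ~~ (1 < totient #[x]) by rewrite -totE // totient_gt1 -leqNgt.
  rewrite totient_gt1 -leqNgt; case: #[x] (order_gt0 x) => [|[|[|]]] //.
have [m _ /(quotient_Sym_morphism _ _ nNG)[phi [ker_phi im_phi]]] := symGN.
have phi2 : {in G, forall x, phi x ^+ 2 = 1 -> x ^+ 2 = 1}.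
  move=> x Gx; rewrite -morphX // => phix2; apply: sqr_lift => //.
  have Nx2 : x ^+ 2 \in N by rewrite -ker_phi; apply/kerP; rewrite ?groupX.
  have nNx : x \in 'N(N) by apply: (subsetP (normal_norm nNG)).
  by rewrite -(morphX (coset_morphism N)) //= coset_id.
have [M nMG] := normal_complement_ker_Sym phi im_phi phi2.
rewrite ker_phi => complM; have [tiNM defG] := complP complM.
have cNG : G \subset 'C(N).
  by rewrite -ker_phi; apply: (central_ker_Sym phi im_phi phi2).
split; last 1 first.
- have cNM : M \subset 'C(N) := subset_trans (normal_sub nMG) cNG.
  have defNM : N \x M = G by rewrite dprodE.
  apply: (isog_dprod defNM (setX_dprod N (G / N)%G)); first exact: isog_setX1.
  have isoM : M \isog (G / N)%G.
    by rewrite /= -defG quotientMidl quotient_isog // cents_norm.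
  exact: isog_trans isoM (isog_set1X _ (G / N)%G).
- have sNG := normal_sub nNG.
  apply/abelemP=> //; split; first exact: subset_trans sNG cNG.
  move=> x Nx; apply: sqr_lift; first exact: (subsetP sNG).
  by rewrite coset_id ?expg1n.
by exists M.
Qed.
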